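(* Let $\alpha$ be a positive real number, let $F = \bigcup_{n=1}^\infty \mathbb{C}((x^{1/n}))$ be the field of Puiseux series over $\mathbb{C}$, and let $\sigma$ be the $\mathbb{C}$-automorphism of $F$ determined by $\sigma(x^{1/n}) = \sqrt[n]{\alpha}\,x^{1/n}$ for all $n \geq 1$, where $\sqrt[n]{\alpha}$ is the positive real $n$-th root of $\alpha$. Then $F$ is algebraically closed with respect to $\sigma$; that is, every non-constant polynomial in the skew polynomial ring $F[t,\sigma]$ factors into a product of linear terms (polynomials of degree $1$ in $t$).
   Context: The symbols $x^{1/n}$ are chosen compatibly, $(x^{1/(nk)})^k = x^{1/n}$, so that $x^q$ is defined for all $q\in\mathbb{Q}$. The automorphism $\sigma$ is explicitly $\sigma(\sum_j f_j x^{j/n}) = \sum_j f_j \alpha^{j/n} x^{j/n}$, where $\alpha^{j/n}$ is the positive real power. For an endomorphism $\sigma$ of a field $F$, the skew polynomial ring $F[t,\sigma]$ is the set of polynomials $\sum_i f_i t^i$ with left coefficients $f_i\in F$, with the usual addition and with multiplication determined by $ta = \sigma(a)t$ for all $a \in F$. The field $F$ is called algebraically closed with respect to $\sigma$ if every non-constant polynomial in $F[t,\sigma]$ factors into a product of linear terms. *)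

(* Defs.v *)
From HB Require Import structures.
From mathcomp Require Import all_boot all_order all_algebra.
From mathcomp Require Import complex.
From mathcomp Require Import boolp classical_sets functions fsbigop.
From mathcomp Require Import reals exp.

Set Implicit Arguments.
Unset Strict Implicit.
Unset Printing Implicit Defensive.

Import Order.TTheory GRing.Theory Num.Theory.
Local Open Scope ring_scope.

(* F[t, sigma] has the same underlying additive group as F[t]; p stands for
   \sum_i p`_i t^i, with the coefficients on the left. The argument sigma is
   there only to key the skew ring structure. *)
Definition skew_poly (F : fieldType) of {rmorphism F -> F} := {poly F}.

Section SkewPoly.
Variables (F : fieldType) (sigma : {rmorphism F -> F}).
Local Notation skew := (skew_poly sigma).
Implicit Types (a b : F) (i j k : nat) (p q r : skew).

HB.instance Definition _ := GRing.Zmodule.copy skew {poly F}.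

(* The bilinear extension of (a t^i) (b t^j) = a sigma^i(b) t^(i + j). *)
Definition skew_mul p q : skew :=
  \poly_(k < (size p + size q).-1)
     (\sum_(i < k.+1) p`_i * iter i sigma q`_(k - i)).

Definition skew_const a : skew := polyC a.
Definition skew_t : skew := polyX F.

Lemma iter_sigma0 i : iter i sigma 0 = 0.
Proof. by elim: i => //= i ->; rewrite rmorph0. Qed.

Lemma iter_sigma1 i : iter i sigma 1 = 1.
Proof. by elim: i => //= i ->; rewrite rmorph1. Qed.

Lemma iter_sigmaD i a b : iter i sigma (a + b) = iter i sigma a + iter i sigma b.
Proof. by elim: i => //= i ->; rewrite rmorphD. Qed.

Lemma iter_sigmaM i a b : iter i sigma (a * b) = iter i sigma a * iter i sigma b.
Proof. by elim: i => //= i ->; rewrite rmorphM. Qed.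

Lemma iter_sigma_sum i (I : finType) (P : pred I) (f : I -> F) :
  iter i sigma (\sum_(j | P j) f j) = \sum_(j | P j) iter i sigma (f j).
Proof. by apply: big_morph; [exact: iter_sigmaD | exact: iter_sigma0]. Qed.

Lemma coef_skew_mul p q k :
  (skew_mul p q)`_k = \sum_(i < k.+1) p`_i * iter i sigma q`_(k - i).
Proof.
rewrite coef_poly ltn_predRL; case: leqP => // le_pq_i1.
rewrite big1 // => j _; have [lq_p_j|lt_j_p] := leqP (size p) j.
  by rewrite nth_default ?mul0r.
rewrite [q`__]nth_default ?iter_sigma0 ?mulr0 // leq_subRL -ltnS //.
by rewrite (leq_trans _ le_pq_i1) // ltn_add2r.
Qed.

Lemma coef_skew_mul_rev p q k :
  (skew_mul p q)`_k = \sum_(i < k.+1) p`_(k - i) * iter (k - i) sigma q`_i.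
Proof.
rewrite coef_skew_mul (reindex_inj rev_ord_inj) /=.
by apply: eq_bigr => j _; rewrite (sub_ordK j).
Qed.

Lemma skew_mulA : associative skew_mul.
Proof.
move=> p q r; apply/polyP => i; rewrite coef_skew_mul coef_skew_mul_rev.
pose coef3 j k :=
  p`_j * (iter j sigma q`_(i - j - k)%N * iter (i - k)%N sigma r`_k).
transitivity (\sum_(j < i.+1) \sum_(k < i.+1 | (k <= i - j)%N) coef3 j k).
  apply: eq_bigr => /= j _; rewrite coef_skew_mul_rev iter_sigma_sum big_distrr /=.
  rewrite (big_ord_narrow_leq (leq_subr _ _)); apply: eq_bigr => k _.
  rewrite /coef3 iter_sigmaM -iterD /= addnBA -1?ltnS ?ltn_ord//.
  by rewrite subnKC// -ltnS ltn_ord.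
rewrite (exchange_big_dep predT) //=; apply: eq_bigr => k _.
transitivity (\sum_(j < i.+1 | (j <= i - k)%N) coef3 j k).
  apply: eq_bigl => j; rewrite -ltnS -(ltnS j) -!subSn ?leq_ord //.
  by rewrite -subn_gt0 -(subn_gt0 j) -!subnDA addnC.
rewrite (big_ord_narrow_leq (leq_subr _ _)) coef_skew_mul big_distrl /=.
by apply: eq_bigr => j _; rewrite /coef3 -!subnDA addnC mulrA.
Qed.

Lemma skew_mul1l : left_id (skew_const 1) skew_mul.
Proof.
move=> p; apply/polyP => i; rewrite coef_skew_mul big_ord_recl subn0.
by rewrite big1 => [|j _]; rewrite coefC /= ?mul1r ?addr0 ?mul0r.
Qed.

Lemma skew_mul1r : right_id (skew_const 1) skew_mul.
Proof.
move=> p; apply/polyP => i; rewrite coef_skew_mul_rev big_ord_recl subn0.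
rewrite big1 => [|j _]; rewrite coefC /= ?iter_sigma1 ?mulr1 ?addr0 //.
by rewrite iter_sigma0 mulr0.
Qed.

Lemma skew_mulDl : left_distributive skew_mul +%R.
Proof.
move=> p q r; apply/polyP=> i; rewrite coefD !coef_skew_mul -big_split.
by apply: eq_bigr => j _; rewrite coefD mulrDl.
Qed.

Lemma skew_mulDr : right_distributive skew_mul +%R.
Proof.
move=> p q r; apply/polyP=> i; rewrite coefD !coef_skew_mul -big_split.
by apply: eq_bigr => j _; rewrite coefD iter_sigmaD mulrDr.
Qed.

Lemma skew_1_neq0 : skew_const 1 != 0.
Proof. by rewrite polyC_eq0 oner_neq0. Qed.

HB.instance Definition _ := GRing.Zmodule_isNzRing.Build skew
  skew_mulA skew_mul1l skew_mul1r skew_mulDl skew_mulDr skew_1_neq0.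

Lemma skew_tC a : skew_t * skew_const a = skew_const (sigma a) * skew_t.
Proof.
have tE i : skew_t`_i = (i == 1%N)%:R by exact: coefX.
have cE b i : (skew_const b)`_i = if i is 0 then b else 0.
  by rewrite coefC; case: i.
apply/polyP => -[|k]; rewrite [LHS]coef_skew_mul [RHS]coef_skew_mul.
  by rewrite !big_ord1 !tE mul0r mulr0.
rewrite [RHS]big_ord_recl [X in _ = _ + X]big1 => [|i _]; last first.
  by rewrite cE mul0r.
rewrite big_ord_recl tE mul0r add0r big_ord_recl tE mul1r.
rewrite big1 => [|i _]; last by rewrite tE mul0r.
rewrite !addr0 /= !cE tE eqSS subSS subn0.
by case: k => [|k]; rewrite ?mulr1// rmorph0 mulr0.
Qed.

Definition skew_deg p : nat := (size (p : {poly F})).-1.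

Definition skew_algebraically_closed : Prop :=
  forall p : skew, (0 < skew_deg p)%N ->
  exists s : seq skew,
    (forall l, l \in s -> skew_deg l = 1%N) /\ p = \prod_(l <- s) l.

End SkewPoly.

Section Puiseux.
Variable K : fieldType.
Implicit Types (f g h : rat -> K) (n k : nat) (m : int) (q : rat).

Definition expo n m k : rat := (m + k%:Z)%:~R / n%:R.

(* A function f : rat -> K stands for the formal sum \sum_q (f q) x^q. It lies in
   K((x^(1/n))) when f is supported on {m/n, (m+1)/n, (m+2)/n, ...}
   for some integer m. *)
Definition laurent_supp n m f : Prop :=
  forall q, f q != 0 -> exists k, q = expo n m k.

Definition is_puiseux : pred (rat -> K) := fun f =>
  `[< exists n m, (0 < n)%N /\ laurent_supp n m f >].

(* The sum has finite support when f and g are Puiseux series. *)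
Definition conv f g : rat -> K := fun q =>
  \sum_(a \in [set: rat]) f a * g (q - a).

Lemma expoD n m m' k l : expo n m k + expo n m' l = expo n (m + m') (k + l).
Proof. by rewrite /expo -mulrDl -intrD PoszD addrACA. Qed.

Lemma expo_inj n m : (0 < n)%N -> injective (expo n m).
Proof.
move=> n0 k l /(mulIf _) E; have : (n%:R^-1 : rat) != 0.
  by rewrite invr_neq0// pnatr_eq0 -lt0n.
by move=> /E/intr_inj/addrI[].
Qed.

Lemma laurent_suppM n m d f : (0 < d)%N ->
  laurent_supp n m f -> laurent_supp (n * d) (m * d%:Z) f.
Proof.
move=> d0 fS q /fS[k ->]; exists (k * d)%N.
rewrite /expo PoszM -mulrDl intrM natrM invfM mulrACA divff ?mulr1//.
by rewrite pnatr_eq0 -lt0n.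
Qed.

Lemma laurent_supp_le n m m' f : m' <= m ->
  laurent_supp n m f -> laurent_supp n m' f.
Proof.
move=> m'm fS q /fS[k ->]; exists (`|m - m'|%N + k)%N.
by rewrite /expo PoszD gez0_abs ?subr_ge0// addrA subrKC.
Qed.

Lemma laurent_supp0 n m f q : laurent_supp n m f ->
  (forall k, q <> expo n m k) -> f q = 0.
Proof. by move=> fS qE; apply/eqP; apply: contrapT => /negP/fS[k /qE]. Qed.

Lemma is_puiseuxP f :
  reflect (exists n m, (0 < n)%N /\ laurent_supp n m f) (is_puiseux f).
Proof. exact: asboolP. Qed.

Lemma common_supp (s : seq (rat -> K)) : (forall f, f \in s -> is_puiseux f) ->
  exists n m, (0 < n)%N /\ (forall f, f \in s -> laurent_supp n m f).
Proof.
elim: s => [_|f s IH sP]; first by exists 1%N, 0.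
have [g gs|n [m [n0 sS]]] := IH; first by apply: sP; rewrite inE gs orbT.
have /is_puiseuxP[n' [m' [n'0 fS]]] : is_puiseux f by apply: sP; rewrite mem_head.
exists (n * n')%N, (Num.min (m * n'%:Z) (m' * n%:Z)).
split=> [|g]; first by rewrite muln_gt0 n0.
rewrite inE => /predU1P[->|/sS gS].
  apply: (@laurent_supp_le _ (m' * n%:Z)); first by rewrite ge_min lexx orbT.
  by rewrite mulnC; apply: laurent_suppM.
apply: (@laurent_supp_le _ (m * n'%:Z)); first by rewrite ge_min lexx.
exact: laurent_suppM.
Qed.

Lemma conv_expo n m m' f g k : (0 < n)%N ->
    laurent_supp n m f -> laurent_supp n m' g ->
  conv f g (expo n (m + m') k) =
  \sum_(i < k.+1) f (expo n m i) * g (expo n m' (k - i)).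
Proof.
move=> n0 fS gS.
rewrite /conv (fsbigE [seq expo n m i | i <- iota 0 k.+1]); first last.
- move=> a _ aN; apply/eqP; apply: contraNT aN.
  rewrite mulf_eq0 negb_or => /andP[/fS[i ->] /gS[j /eqP]].
  rewrite subr_eq expoD [m' + m]addrC => /eqP/(expo_inj n0) kE.
  by apply: map_f; rewrite mem_iota add0n ltnS kE leq_addl.
- by [].
- by rewrite map_inj_uniq ?iota_uniq//; exact: expo_inj.
have -> : iota 0 k.+1 = index_iota 0 k.+1 by rewrite /index_iota subn0.
rewrite big_map (eq_bigl predT) => [|i]; last by rewrite in_setT.
rewrite big_mkord; apply: eq_bigr => i _; congr (_ * g _).
by apply/eqP; rewrite subr_eq expoD [m' + m]addrC subnK// -ltnS.
Qed.

Lemma conv_supp n m m' f g :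
    laurent_supp n m f -> laurent_supp n m' g ->
  laurent_supp n (m + m') (conv f g).
Proof.
move=> fS gS q q0.
have [a] : exists a, f a * g (q - a) != 0.
  apply: contrapT => /forallNP N; move/eqP: q0; apply.
  by apply: fsbig1 => a _; apply/eqP; apply: contrapT => /negP /N.
rewrite mulf_eq0 negb_or => /andP[/fS[i aE] /gS[j qE]].
by exists (i + j)%N; rewrite -expoD -aE -qE subrKC.
Qed.

Lemma eq_laurent n m f g : laurent_supp n m f -> laurent_supp n m g ->
  (forall k, f (expo n m k) = g (expo n m k)) -> f = g.
Proof.
move=> fS gS fg; apply/funext => q.
have [[k ->]|N] := pselect (exists k, q = expo n m k); first exact: fg.
by rewrite (laurent_supp0 fS) ?(laurent_supp0 gS)// => k qE; apply: N; exists k.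
Qed.

Lemma conv_puiseux f g : is_puiseux f -> is_puiseux g -> is_puiseux (conv f g).
Proof.
move=> fP gP; have [|n [m [n0 S]]] := @common_supp [:: f; g].
  by move=> h; rewrite mem_seq2 => /orP[] /eqP->.
apply/is_puiseuxP; exists n, (m + m); split => //.
by apply: conv_supp; apply: S; rewrite !inE eqxx ?orbT.
Qed.

Lemma convC f g : is_puiseux f -> is_puiseux g -> conv f g = conv g f.
Proof.
move=> fP gP; have [|n [m [n0 S]]] := @common_supp [:: f; g].
  by move=> h; rewrite mem_seq2 => /orP[] /eqP->.
have [fS gS] : laurent_supp n m f /\ laurent_supp n m g.
  by split; apply: S; rewrite !inE eqxx ?orbT.
apply: eq_laurent (conv_supp fS gS) (conv_supp gS fS) _ => k.
rewrite !conv_expo// (reindex_inj rev_ord_inj); apply: eq_bigr => i _ /=.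
by rewrite mulrC subSS subKn// -ltnS.
Qed.

Lemma convA f g h : is_puiseux f -> is_puiseux g -> is_puiseux h ->
  conv f (conv g h) = conv (conv f g) h.
Proof.
move=> fP gP hP; have [|n [m [n0 S]]] := @common_supp [:: f; g; h].
  by move=> u; rewrite mem_seq3 => /or3P[] /eqP->.
have [fS gS hS] : [/\ laurent_supp n m f, laurent_supp n m g & laurent_supp n m h].
  by split; apply: S; rewrite !inE eqxx ?orbT.
have ghS := conv_supp gS hS; have fgS := conv_supp fS gS.
have lS := conv_supp fS ghS; have rS := conv_supp fgS hS.
rewrite -addrA in rS; apply: eq_laurent lS rS _ => k.
rewrite conv_expo// addrA conv_expo//.
pose T u : {poly K} := \poly_(i < k.+1) u (expo n m i).
have TE u i : (i < k.+1)%N -> (T u)`_i = u (expo n m i).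
  by move=> ik; rewrite coef_poly ik.
have := congr1 (fun p : {poly K} => p`_k) (mulrA (T f) (T g) (T h)).
rewrite coefM [X in _ = X]coefM => E.
transitivity (\sum_(i < k.+1) (T f)`_i * (T g * T h)`_(k - i)); last first.
  rewrite {}E; apply: eq_bigr => i _; rewrite TE ?ltnS ?leq_subr//.
  rewrite coefM conv_expo//; congr (_ * _); apply: eq_bigr => j _.
  have jk : (j < k.+1)%N by rewrite (leq_trans (ltn_ord j)).
  by rewrite !TE// (leq_ltn_trans (leq_subr _ _)).
apply: eq_bigr => i _; rewrite TE// coefM conv_expo//; congr (_ * _).
apply: eq_bigr => j _.
have jk : (j < k.+1)%N by rewrite (leq_trans (ltn_ord j))// ltnS leq_subr.
rewrite !TE// (leq_ltn_trans (leq_subr _ _))//.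
by rewrite (leq_ltn_trans (leq_subr _ _)).
Qed.

Lemma convDl f g h : is_puiseux f -> is_puiseux g -> is_puiseux h ->
  conv (f + g) h = conv f h + conv g h.
Proof.
move=> fP gP hP; have [|n [m [n0 S]]] := @common_supp [:: f; g; h].
  by move=> u; rewrite mem_seq3 => /or3P[] /eqP->.
have [fS gS hS] : [/\ laurent_supp n m f, laurent_supp n m g & laurent_supp n m h].
  by split; apply: S; rewrite !inE eqxx ?orbT.
have addS m' u v : laurent_supp n m' u -> laurent_supp n m' v ->
    laurent_supp n m' (u + v).
  move=> uS vS q uvq; have [uq|/uS//] := eqVneq (u q) 0.
  have [vq|/vS//] := eqVneq (v q) 0.
  by move: uvq; rewrite (_ : (u + v) q = u q + v q)// uq vq addr0 eqxx.
apply: (eq_laurent (conv_supp (addS _ _ _ fS gS) hS)).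
  exact: addS (conv_supp fS hS) (conv_supp gS hS).
move=> k; rewrite [RHS](_ : _ = conv f h (expo n (m + m) k) + conv g h (expo n (m + m) k))//.
rewrite !conv_expo//; last exact: addS.
rewrite -big_split; apply: eq_bigr => i _; exact: mulrDl.
Qed.

Definition monom q : rat -> K := fun r => (r == q)%:R.

Lemma monom_puiseux q : is_puiseux (monom q).
Proof.
apply/is_puiseuxP; exists `|denq q|%N, (numq q).
split=> [|r]; first by rewrite absz_gt0 denq_neq0.
rewrite /monom; have [-> _|_] := eqVneq r q; last by rewrite eqxx.
exists 0%N; rewrite /expo addr0 -[LHS]divq_num_den; congr (_ / _).
by rewrite -[in LHS](gez0_abs (denq_ge0 q)).
Qed.

Lemma conv_monom q f : is_puiseux f -> conv (monom q) f = fun r => f (r - q).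
Proof.
move=> fP; apply/funext => r; rewrite /conv (fsbigE [:: q])//=; last first.
  by move=> i _; rewrite inE /monom => /negbTE ->; rewrite mul0r.
by rewrite big_mkcond big_seq1 in_setT /monom eqxx mul1r.
Qed.

Lemma conv1f f : is_puiseux f -> conv (monom 0) f = f.
Proof. by move=> fP; rewrite conv_monom//; apply/funext => r; rewrite subr0. Qed.

Lemma laurent_inv n m f : (0 < n)%N -> laurent_supp n m f ->
  f (expo n m 0) != 0 ->
  exists2 g, laurent_supp n (- m) g & conv g f = monom 0.
Proof.
move=> n0 fS f0; pose a k := f (expo n m k).
pose next i (s : seq K) := if i is 0 then (a 0%N)^-1 else
  - (a 0%N)^-1 * \sum_(j < i) nth 0 s j * a (i - j)%N.
pose pre := fix pre k : seq K :=
  if k is k'.+1 then rcons (pre k') (next k' (pre k')) else [::].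
have preS k : pre k.+1 = rcons (pre k) (next k (pre k)) by [].
have sz k : size (pre k) = k by elim: k => // k IH; rewrite preS size_rcons IH.
pose b k := next k (pre k).
have nthE k l : (l < k)%N -> nth 0 (pre k) l = b l.
  elim: k => // k IH; rewrite preS nth_rcons sz ltnS leq_eqVlt.
  by case: ltngtP => //= [lk _|-> _]; rewrite ?IH.
have b0 : b 0%N = (a 0%N)^-1 by [].
have bS k : b k.+1 = - (a 0%N)^-1 * \sum_(j < k.+1) b j * a (k.+1 - j)%N.
  by congr (_ * _); apply: eq_bigr => j _; rewrite nthE.
clearbody b.
pose g q := xget 0 [set y | exists2 k, q = expo n (- m) k & y = b k].
have gE k : g (expo n (- m) k) = b k.
  by apply: xget_unique => [|y [l /(expo_inj n0) <-]]//; exists k.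
have gS : laurent_supp n (- m) g.
  move=> q gq; apply: contrapT => N; move/eqP: gq; apply.
  by apply: xgetPN => y [k qE _]; apply: N; exists k.
exists g => //; have oneS : laurent_supp n (- m + m) (monom 0).
  move=> q; rewrite /monom; have [-> _|_] := eqVneq q 0; last by rewrite eqxx.
  by exists 0%N; rewrite /expo addNr addr0 mul0r.
apply: (eq_laurent (conv_supp gS fS) oneS) => k; rewrite conv_expo//.
under eq_bigr do rewrite gE.
rewrite /monom addNr (_ : 0 = expo n 0 0); last by rewrite /expo addr0 mul0r.
rewrite (inj_eq (expo_inj n0)); case: k => [|k].
  by rewrite big_ord1 b0 mulVf.
rewrite big_ord_recr /= subnn -/(a 0%N) bS mulrAC mulNr mulVf// mulN1r.
by rewrite subrr.
Qed.

Lemma conv_inv f : is_puiseux f -> f != 0 ->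
  exists2 g, is_puiseux g & conv g f = monom 0.
Proof.
move=> /is_puiseuxP[n [m [n0 fS]]] fN0.
have ex : exists k, f (expo n m k) != 0.
  apply: contrapT => /forallNP N; move/eqP: fN0; apply; apply/funext => q.
  have [//|/[dup] fq /fS[k qE]] := eqVneq (f q) 0.
  by case: (N k); rewrite -qE.
case: (ex_minnP ex) => k fk kmin.
have shift l : expo n (m + k%:Z) l = expo n m (k + l) by rewrite /expo PoszD addrA.
have fS' : laurent_supp n (m + k%:Z) f.
  move=> q /[dup] fq /fS[l qE]; exists (l - k)%N.
  by rewrite shift subnKC// kmin// -qE.
have [|g gS gf] := laurent_inv n0 fS'; first by rewrite shift addn0.
by exists g => //; apply/is_puiseuxP; exists n, (- (m + k%:Z)).
Qed.

Lemma is_puiseux_zmod : zmod_closed is_puiseux.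
Proof.
split=> [|f g fP gP].
  by apply/is_puiseuxP; exists 1%N, 0; split => // q; rewrite eqxx.
have [|n [m [n0 S]]] := @common_supp [:: f; g].
  by move=> h; rewrite mem_seq2 => /orP[] /eqP->.
have [fS gS] : laurent_supp n m f /\ laurent_supp n m g.
  by split; apply: S; rewrite !inE eqxx ?orbT.
apply/is_puiseuxP; exists n, m; split => // q.
have [fq|/fS//] := eqVneq (f q) 0; have [gq|/gS//] := eqVneq (g q) 0.
by rewrite (_ : (f - g) q = f q - g q)// fq gq subr0 eqxx.
Qed.

HB.instance Definition _ := GRing.isZmodClosed.Build _ is_puiseux is_puiseux_zmod.

Record puiseux := Puiseux
  { puiseux_coef :> rat -> K; puiseux_coefP : puiseux_coef \in is_puiseux }.

HB.instance Definition _ := [isSub for puiseux_coef].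
HB.instance Definition _ := [Choice of puiseux by <:].
HB.instance Definition _ := [SubChoice_isSubZmodule of puiseux by <:].

Definition puiseux_mul (u v : puiseux) : puiseux :=
  Puiseux (conv_puiseux (puiseux_coefP u) (puiseux_coefP v)).

Definition puiseux_X q : puiseux := Puiseux (monom_puiseux q).

Lemma puiseux_mulA : associative puiseux_mul.
Proof. by move=> u v w; apply/val_inj/convA; apply: puiseux_coefP. Qed.

Lemma puiseux_mulC : commutative puiseux_mul.
Proof. by move=> u v; apply/val_inj/convC; apply: puiseux_coefP. Qed.

Lemma puiseux_mul1 : left_id (puiseux_X 0) puiseux_mul.
Proof. by move=> u; apply/val_inj/conv1f; apply: puiseux_coefP. Qed.

Lemma puiseux_mulDl : left_distributive puiseux_mul +%R.
Proof. by move=> u v w; apply/val_inj/convDl; apply: puiseux_coefP. Qed.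

Lemma puiseux_1_neq0 : puiseux_X 0 != 0.
Proof.
apply/eqP => /(congr1 (fun u : puiseux => u 0))/eqP.
by rewrite /= /monom eqxx; exact/negP/oner_neq0.
Qed.

HB.instance Definition _ := GRing.Zmodule_isComNzRing.Build puiseux
  puiseux_mulA puiseux_mulC puiseux_mul1 puiseux_mulDl puiseux_1_neq0.

Definition puiseux_inv (u : puiseux) : puiseux := xget 0 [set v | v * u = 1].

Lemma puiseux_mulVf u : u != 0 -> puiseux_inv u * u = 1.
Proof.
move=> u0; apply: (@xgetPex _ 0 [set v | v * u = 1]).
have [|g gP gu] := conv_inv (puiseux_coefP u).
  by apply: contra_neq u0 => u0; apply/val_inj.
by exists (Puiseux gP); apply/val_inj.
Qed.

Lemma puiseux_inv0 : puiseux_inv 0 = 0.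
Proof.
by apply: xgetPN => v /= /eqP; rewrite mulr0 eq_sym oner_eq0.
Qed.

HB.instance Definition _ := GRing.ComNzRing_isField.Build puiseux
  puiseux_mulVf puiseux_inv0.

Lemma puiseux_XD q r : puiseux_X (q + r) = puiseux_X q * puiseux_X r.
Proof.
apply/val_inj; rewrite [RHS]conv_monom; last exact: monom_puiseux.
by apply/funext => s; rewrite /= /monom subr_eq [r + q]addrC.
Qed.

Lemma puiseux_scale_subproof (c : K) (u : puiseux) :
  (fun q => c * u q) \in is_puiseux.
Proof.
have /is_puiseuxP[n [m [n0 uS]]] := puiseux_coefP u.
apply/is_puiseuxP; exists n, m; split => // q.
by rewrite mulf_eq0 negb_or => /andP[_ /uS].
Qed.

Definition puiseux_scale c u : puiseux := Puiseux (puiseux_scale_subproof c u).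

End Puiseux.

Section Dilation.
Local Open Scope complex_scope.
Variables (R : realType) (alpha : R) (alpha_gt0 : 0 < alpha).
Local Notation F := (puiseux R[i]).

Lemma dilation_subproof (u : F) :
  (fun q : rat => u q * (alpha `^ ratr q)%:C) \in @is_puiseux R[i].
Proof.
have /is_puiseuxP[n [m [n0 uS]]] := puiseux_coefP u.
apply/is_puiseuxP; exists n, m; split => // q.
by rewrite mulf_eq0 negb_or => /andP[/uS].
Qed.

Definition dilation of 0 < alpha := fun u : F => Puiseux (dilation_subproof u).
Local Notation sigma := (dilation alpha_gt0).

Lemma dilation_additive : zmod_morphism sigma.
Proof. by move=> u v; apply/val_inj/funext => q; apply: mulrBl. Qed.

Lemma dilation_multiplicative : monoid_morphism sigma.
Proof.
split=> [|u v]; apply/val_inj/funext => q.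
  rewrite /= /monom; case: eqVneq => [->|_]; last by rewrite mul0r.
  by rewrite rmorph0 powRr0 mulr1.
rewrite /= /conv mulr_fsuml; apply: eq_fsbigr => a _.
rewrite mulrACA; congr (_ * _); rewrite -rmorphM -powRD ?(gt_eqF alpha_gt0) ?implybT//.
by rewrite -rmorphD subrKC.
Qed.

HB.instance Definition _ :=
  GRing.isZmodMorphism.Build F F sigma dilation_additive.
HB.instance Definition _ :=
  GRing.isMonoidMorphism.Build F F sigma dilation_multiplicative.

Lemma dilation_scale c u :
  sigma (puiseux_scale c u) = puiseux_scale c (sigma u).
Proof. by apply/val_inj/funext => q; rewrite /= mulrA. Qed.

Lemma dilation_X q :
  sigma (puiseux_X R[i] q) = puiseux_scale (alpha `^ ratr q)%:C (puiseux_X R[i] q).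
Proof.
apply/val_inj/funext => r; rewrite /= /monom.
by case: eqVneq => [->|_]; rewrite ?mulr0 ?mul0r// mulrC.
Qed.

Lemma dilation_Xroot n : sigma (puiseux_X R[i] n%:R^-1) =
  puiseux_scale (alpha `^ n%:R^-1)%:C (puiseux_X R[i] n%:R^-1).
Proof.
have E : ratr n%:R^-1 = n%:R^-1 :> R by rewrite fmorphV rmorph_nat.
by rewrite dilation_X E.
Qed.

End Dilation.

Lemma dilationK (R : realType) (alpha beta : R) (alpha_gt0 : 0 < alpha)
    (beta_gt0 : 0 < beta) : alpha * beta = 1 ->
  cancel (dilation alpha_gt0) (dilation beta_gt0).
Proof.
move=> ab u; apply/val_inj/funext => q /=.
by rewrite -mulrA -rmorphM -powRM ?ltW// ab powR1 rmorph1 mulr1.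
Qed.

Lemma dilation_bij (R : realType) (alpha : R) (alpha_gt0 : 0 < alpha) :
  bijective (dilation alpha_gt0).
Proof.
have alphaV_gt0 : 0 < alpha^-1 by rewrite invr_gt0.
exists (dilation alphaV_gt0); apply: dilationK.
  by rewrite mulfV// gt_eqF.
by rewrite mulVf// gt_eqF.
Qed.

(* Main.v *)
(* Every p of degree at least 2 is a product of two skew polynomials of positive
   degree. After a substitution t -> x^q t with q read off the Newton polygon, and
   a normalisation, the coefficients of p = \sum_k x^(k/n) P_k lie in
   C[[x^(1/n)]] and P_0 in C[t] is monic, different from t^d. Since
   t x^(1/n) = b x^(1/n) t with b = alpha^(1/n), a product satisfies
   (gh)_k = \sum_a G_a(b^(k - a) t) H_(k - a), so a factorization P_0 = g h lifts
   as soon as g(b^k t) and h are coprime for all k > 0 (for alpha = 1 this is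
   Hensel's lemma). If alpha != 1, the factor t - c with c a root of P_0 of maximal
   modulus can be split off in this way, on the side given by the position of
   alpha with respect to 1. If alpha = 1, a translation of t first kills the
   coefficient of degree d - 1, so that P_0 has two distinct roots. *)
Require Import Defs.
From HB Require Import structures.
From mathcomp Require Import all_boot all_order all_algebra.
From mathcomp Require Import complex reals.
From mathcomp Require Import boolp classical_sets fsbigop exp.
From mathcomp Require Import zify.

Import Order.TTheory GRing.Theory Num.Theory.
Local Open Scope ring_scope.

(** * Factorizations of skew polynomials over a general field *)

Section SkewFactorization.
Context {F : fieldType} (sigma : {rmorphism F -> F}).
Implicit Types (p q g h : {poly F}) (N : nat -> F).
Local Notation "p ** q" := (@skew_mul F sigma p q : {poly F}) (at level 40).

Lemma iter_sigma_eq0 i (a : F) : (iter i sigma a == 0) = (a == 0).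
Proof. by elim: i => //= i <-; rewrite fmorph_eq0. Qed.

Lemma iter_sigmaV i (a : F) : iter i sigma a^-1 = (iter i sigma a)^-1.
Proof. by elim: i => //= i ->; rewrite fmorphV. Qed.

(** The top coefficient is lead(p) sigma^deg(p)(lead(q)), nonzero because sigma is injective. *)
Lemma size_skew_mul p q : p != 0 -> q != 0 ->
  size (p ** q) = (size p + size q).-1.
Proof.
move=> p0 q0; rewrite /skew_mul size_poly_eq//.
have sp : size p = (size p).-1.+1 by rewrite prednK// size_poly_gt0.
have sq : size q = (size q).-1.+1 by rewrite prednK// size_poly_gt0.
have -> : (size p + size q).-1.-1 = ((size p).-1 + (size q).-1)%N.
  by rewrite sp sq /= addnS.
have lp : ((size p).-1 < ((size p).-1 + (size q).-1).+1)%N.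
  by rewrite ltnS leq_addr.
rewrite (bigD1 (Ordinal lp))//= addKn big1 ?addr0 => [|i /eqP iN].
  by rewrite mulf_eq0 iter_sigma_eq0 -!/(lead_coef _) !lead_coef_eq0 negb_or p0.
have [ilt|igt|ieq] := ltngtP (i : nat) (size p).-1.
- rewrite [q`__]nth_default ?iter_sigma0 ?mulr0//.
  rewrite leq_subRL; last by rewrite (leq_trans (ltnW ilt))// leq_addr.
  by rewrite [X in (_ + X <= _)%N]sq addnS -addSn leq_add2r.
- by rewrite [p`__]nth_default ?mul0r// (leq_trans _ igt)// -sp.
- by case: iN; apply/val_inj.
Qed.

Definition splits p := exists g h,
  [/\ (1 < size g)%N, (1 < size h)%N & g ** h = p].

(** Strong induction on the degree: degrees add up, so both factors of a splitting have smaller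
    degree. *)
Lemma closed_of_splits :
  (forall p, (2 < size p)%N -> splits p) -> skew_algebraically_closed sigma.
Proof.
move=> spl p; have [n] := ubnP (skew_deg p).
elim: n p => // n IH p pn p0.
have [p2|p2] := leqP (size (p : {poly F})) 2.
  exists [:: p]; split; last by rewrite big_seq1.
  move=> l; rewrite inE => /eqP ->; move: p0 p2; rewrite /skew_deg.
  by case: (size _) => [|[|[]]].
have [g [h [g1 h1 E]]] := spl _ p2.
have gh := @size_skew_mul g h; rewrite E in gh.
have {}gh : size (p : {poly F}) = (size g + size h).-1.
  by apply: gh; rewrite -size_poly_gt0; lia.
have [|| sg [sgP gE]] := IH g; rewrite ?/skew_deg; [|lia|].
  by move: pn; rewrite /skew_deg gh; lia.
have [|| sh [shP hE]] := IH h; rewrite ?/skew_deg; [|lia|].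
  by move: pn; rewrite /skew_deg gh; lia.
exists (sg ++ sh); split.
  by move=> l; rewrite mem_cat => /orP[/sgP|/shP].
by rewrite big_cat /= -gE -hE -E.
Qed.

(** A scalar on the left is absorbed by the left factor. *)
Lemma splits_scale (a : F) p : a != 0 -> splits (a *: p) -> splits p.
Proof.
move=> a0 [g [h [g1 h1 E]]]; exists (a^-1 *: g), h.
split; rewrite ?size_scale ?invr_eq0//.
have -> : p = a^-1 *: (a *: p) by rewrite scalerA mulVf// scale1r.
rewrite -E; apply/polyP => k; rewrite coefZ !coef_skew_mul mulr_sumr.
by apply: eq_bigr => i _; rewrite coefZ mulrA.
Qed.

(* When N is a cocycle, twisting by N is the ring automorphism t |-> N 1 * t. *)
Definition cocycle N := forall i j, N (i + j)%N = N i * iter i sigma (N j).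

Definition twist N p : {poly F} := \poly_(i < size p) (p`_i * N i).

Lemma coef_twist N p i : (twist N p)`_i = p`_i * N i.
Proof.
by rewrite coef_poly; case: ltnP => // pi; rewrite nth_default// mul0r.
Qed.

Lemma size_twist N p : (forall i, N i != 0) -> size (twist N p) = size p.
Proof.
move=> N0; have [->|p0] := eqVneq p 0.
  by rewrite /twist size_poly0 poly_def big_ord0 size_poly0.
by rewrite size_poly_eq// mulf_neq0// -/(lead_coef p) lead_coef_eq0.
Qed.

Lemma twistM N p q : cocycle N ->
  twist N (p ** q) = twist N p ** twist N q.
Proof.
move=> NM; apply/polyP => k.
rewrite coef_twist [LHS](congr1 (fun x => x * _) (@coef_skew_mul F sigma p q k)).
rewrite [RHS](@coef_skew_mul F sigma (twist N p) (twist N q) k) mulr_suml.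
apply: eq_bigr => i _; rewrite !coef_twist iter_sigmaM mulrACA -NM.
by rewrite subnKC// -ltnS.
Qed.

(** The pointwise inverse of [N] is again a cocycle; twisting by it undoes the twist and carries the
    two factors along. *)
Lemma splits_twist N p : (forall i, N i != 0) -> cocycle N ->
  splits (twist N p) -> splits p.
Proof.
move=> N0 NM [g [h [g1 h1 E]]]; pose M i := (N i)^-1.
have M0 i : M i != 0 by rewrite invr_eq0.
have MM : cocycle M by move=> i j; rewrite /M NM invfM iter_sigmaV.
exists (twist M g), (twist M h); rewrite !size_twist//; split=> //.
rewrite -twistM// E; apply/polyP => i.
by rewrite !coef_twist mulfK.
Qed.

End SkewFactorization.


(** * A twisted Hensel lemma for sequences of polynomials *)

Section HenselSequences.
Context {K : fieldType}.
Implicit Types (p q g h r : {poly K}) (b c : K).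

Lemma coef_comp_scaleX p c i : (p \Po (c *: 'X))`_i = p`_i * c ^+ i.
Proof.
rewrite comp_polyE coef_sum.
under eq_bigr do rewrite exprZn !coefZ coefXn.
have [pi|pi] := leqP (size p) i.
  rewrite nth_default// mul0r big1// => j _.
  by rewrite [i == j]gtn_eqF ?mulr0// (leq_trans (ltn_ord j)).
rewrite (bigD1 (Ordinal pi))//= eqxx mulr1 big1 ?addr0// => j.
by rewrite -val_eqE /= eq_sym => /negPf ->; rewrite !mulr0.
Qed.

Lemma size_comp_scaleX p c : c != 0 -> size (p \Po (c *: 'X)) = size p.
Proof. by move=> c0; rewrite size_comp_poly2// size_scale// size_polyX. Qed.

(** In a Bezout relation multiplied by r, the cofactor of g is reduced modulo h and the quotient is
    moved to u. The bound on u then follows from those on r and v. *)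
Lemma coprimep_solve g h r : coprimep g h -> g != 0 -> h != 0 ->
    (size r <= (size g + size h).-1)%N ->
  exists u v : {poly K}, [/\ (size u <= size g)%N, (size v <= size h)%N & r = u * h + g * v].
Proof.
move=> /Bezout_eq1_coprimepP[[a b] /= ab] g0 h0 rs.
pose v := (r * a) %% h; pose u := r * b + g * ((r * a) %/ h).
have E : r = u * h + g * v.
  rewrite /u mulrDl -addrA -[g * _ * h]mulrA -mulrDr -divp_eq.
  by rewrite -mulrA [g * _]mulrC -mulrA -mulrDr addrC ab mulr1.
have vs : (size v < size h)%N by rewrite ltn_modp.
exists u, v; split => //; last exact: ltnW.
have [->|u0] := eqVneq u 0; first by rewrite size_poly0.
have us : (size (u * h)%R <= (size g + size h).-1)%N.
  have -> : u * h = r - g * v by rewrite {1}E addrK.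
  rewrite (leq_trans (size_polyD _ _))// geq_max rs size_polyN.
  rewrite (leq_trans (size_polyMleq _ _))//.
    by rewrite -!subn1 leq_sub2r// leq_add2l ltnW.
move: us; rewrite size_mul//.
move: g0 h0 u0; rewrite -!size_poly_gt0.
by move: (size u) (size g) (size h) => x y z; lia.
Qed.

(* The x^k-coefficient of (\sum_k x^k G_k) (\sum_k x^k H_k) when
   t x = b x t. *)
Definition twisted_conv b (G H : nat -> {poly K}) k : {poly K} :=
  \sum_(a < k.+1) (G a \Po (b ^+ (k - a) *: 'X)) * H (k - a)%N.

Lemma twisted_convS b G H k : twisted_conv b G H k.+1 =
  G k.+1 * H 0 + ((G 0 \Po (b ^+ k.+1 *: 'X)) * H k.+1 +
    \sum_(i < k) (G i.+1 \Po (b ^+ (k - i) *: 'X)) * H (k - i)%N).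
Proof.
rewrite /twisted_conv big_ord_recr big_ord_recl /= subnn subn0.
by rewrite expr0 scale1r comp_polyXr addrC.
Qed.

(** At each index k > 0 the new unknowns enter linearly, through G_k h + g(b^k X) H_k; all other
    terms are already known, and coprimality solves the equation. *)
Lemma hensel b (P : nat -> {poly K}) g h : b != 0 -> g != 0 -> h != 0 ->
    (forall k, (0 < k)%N -> coprimep (g \Po (b ^+ k *: 'X)) h) ->
    P 0 = g * h -> (forall k, (size (P k) <= size (P 0))%N) ->
  exists G H : nat -> {poly K}, [/\ G 0 = g, H 0 = h, (forall k, (size (G k) <= size g)%N),
    (forall k, (size (H k) <= size h)%N) & forall k, P k = twisted_conv b G H k].
Proof.
move=> b0 g0 h0 cop P0 Ps; pose x0 : {poly K} * {poly K} := (0, 0).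
(* The list s holds the pairs (G_k, H_k) found so far; the default (0, 0) past its end keeps the
   size bounds valid for every k. *)
pose A (s : seq ({poly K} * {poly K})) := [/\ nth x0 s 0 = (g, h),
  forall k, (size (nth x0 s k).1 <= size g)%N,
  forall k, (size (nth x0 s k).2 <= size h)%N &
  forall k, (k < size s)%N -> P k =
    twisted_conv b (fun i => (nth x0 s i).1) (fun i => (nth x0 s i).2) k].
have step s : A s -> (0 < size s)%N -> exists y, A (rcons s y).
  case=> s0 sg sh sP; case sk: (size s) => [//|k] _.
  (* What remains for the terms containing G_(k+1) or H_(k+1). *)
  pose r := P k.+1 - \sum_(i < k)
    ((nth x0 s i.+1).1 \Po (b ^+ (k - i) *: 'X)) * (nth x0 s (k - i)).2.
  have szb c : c != 0 -> size (g \Po (c *: 'X)) = size g by exact: size_comp_scaleX.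
  have bk0 i : b ^+ i != 0 by rewrite expf_neq0.
  have gb0 i : g \Po (b ^+ i *: 'X) != 0.
    by rewrite -size_poly_gt0 szb// size_poly_gt0.
  have [|u [v [us vs E]]] :=
    @coprimep_solve _ _ r (cop k.+1 isT) (gb0 k.+1) h0.
    rewrite szb// -size_mul// -P0 (leq_trans (size_polyD _ _))// geq_max Ps size_polyN.
    apply: leq_trans (size_sum _ _ _) _; apply/bigmax_leqP => i _.
    rewrite (leq_trans (size_polyMleq _ _))// P0 size_mul//.
    rewrite size_comp_scaleX// -[leqLHS]subn1 -[leqRHS]subn1 leq_sub2r// leq_add//.
  rewrite szb// in us.
  have nthr i : nth x0 (rcons s (u, v)) i =
      if (i < k.+1)%N then nth x0 s i else if i == k.+1 then (u, v) else x0.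
    by rewrite nth_rcons sk.
  exists (u, v); split.
  - by rewrite nthr.
  - move=> i; rewrite nthr; case: ifP => // _; case: ifP => // _.
    by rewrite size_poly0.
  - move=> i; rewrite nthr; case: ifP => // _; case: ifP => // _.
    by rewrite size_poly0.
  - move=> i; rewrite size_rcons sk ltnS leq_eqVlt => /predU1P[->|ik]; last first.
      rewrite sP ?sk//; apply: eq_bigr => j _.
      have jk : (j < k.+1)%N by rewrite (leq_trans (ltn_ord j)).
      by rewrite !nthr jk (leq_ltn_trans (leq_subr _ _) ik).
    rewrite twisted_convS !nthr ltnn eqxx s0 /= addrA -E /r.
    apply/eqP; rewrite -subr_eq; apply/eqP; congr (_ - _).
    apply: eq_bigr => j _; rewrite !nthr !ltnS ltn_ord.
    by rewrite (leq_trans (leq_subr _ _)).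
have init : A [:: (g, h)].
  split=> //; do ?by case=> [|[|i]]//=; rewrite size_poly0.
  case=> // _; rewrite /twisted_conv big_ord1 /= expr0 scale1r comp_polyXr.
  by rewrite P0.
pose next s := rcons s (xget x0 [set y | A (rcons s y)]%classic).
pose pre k := iter k next [:: (g, h)].
have sz k : size (pre k) = k.+1 by elim: k => //= k IH; rewrite size_rcons IH.
have preA k : A (pre k).
  elim: k => // k IH; have := step _ IH; rewrite sz => /(_ isT).
  exact: (@xgetPex _ x0 [set y | A (rcons (pre k) y)]%classic).
(* Extending a list preserves its entries, so the last entries of the lists [pre k] form a coherent
   sequence. *)
have stable k d i : (i <= k)%N -> nth x0 (pre (k + d)%N) i = nth x0 (pre k) i.
  move=> ik; elim: d => [|d IH]; first by rewrite addn0.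
  by rewrite addnS /= nth_rcons sz -IH (leq_ltn_trans ik)// ltnS leq_addr.
have preE k i : (i <= k)%N -> nth x0 (pre k) i = nth x0 (pre i) i.
  by move=> ik; rewrite -(stable i (k - i)%N)// subnKC.
clearbody pre; exists (fun k => (nth x0 (pre k) k).1), (fun k => (nth x0 (pre k) k).2); split.
- by case: (preA 0%N) => ->.
- by case: (preA 0%N) => ->.
- by move=> k; case: (preA k).
- by move=> k; case: (preA k).
- move=> k; case: (preA k) => _ _ _ /(_ k); rewrite sz ltnSn => -> //.
  apply: eq_bigr => i _ /=; have ik : (i <= k)%N by rewrite -ltnS.
  rewrite (preE k i)//.
  by rewrite (preE k (k - i)%N) ?leq_subr.
Qed.

End HenselSequences.

(** * Coefficients and orders of Puiseux series *)

Section PuiseuxCoefficients.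
Context {K : fieldType}.
Implicit Types (u v : puiseux K) (q r : rat) (n k : nat).

Lemma puiseux_coefD u v q : (u + v) q = u q + v q.
Proof. by []. Qed.

Lemma puiseux_coef0 q : (0 : puiseux K) q = 0.
Proof. by []. Qed.

Lemma puiseux_coef1 q : (1 : puiseux K) q = (q == 0)%:R.
Proof. by []. Qed.

Lemma puiseux_coef_sum (I : Type) (s : seq I) (P : pred I) (f : I -> puiseux K) q :
  (\sum_(i <- s | P i) f i) q = \sum_(i <- s | P i) f i q.
Proof. by apply: (big_morph (fun u => u q)) => // u v; exact: puiseux_coefD. Qed.

Lemma expo00 n : expo n 0 0 = 0.
Proof. by rewrite /expo addr0 mul0r. Qed.

Lemma laurent_supp_sum n m (I : Type) (s : seq I) (P : pred I) (f : I -> puiseux K) :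
  (forall i, P i -> laurent_supp n m (f i)) ->
  laurent_supp n m (\sum_(i <- s | P i) f i).
Proof.
move=> fS q; rewrite puiseux_coef_sum => sN0; apply: contrapT => N.
move/eqP: sN0; apply; rewrite big1// => i Pi.
by apply: laurent_supp0 (fS i Pi) _ => k qE; apply: N; exists k.
Qed.

(** The numerators m + k of the exponents that occur are nonnegative and serve as new indices. *)
Lemma laurent_supp_nneg n m u : (0 < n)%N -> laurent_supp n m u ->
  (forall q, q < 0 -> u q = 0) -> laurent_supp n 0 u.
Proof.
move=> n0 uS u0 q uq; have [k qE] := uS _ uq.
have q0 : 0 <= q by rewrite leNgt; apply: contra uq => /u0 ->.
exists (absz (m + k%:Z)%R); rewrite qE /expo add0r gez0_abs//.
move: q0; rewrite qE /expo pmulr_lge0 ?ler0z//.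
by rewrite invr_gt0 ltr0n.
Qed.

Lemma mul_expo n k u v : (0 < n)%N -> laurent_supp n 0 u -> laurent_supp n 0 v ->
  (u * v) (expo n 0 k) = \sum_(i < k.+1) u (expo n 0 i) * v (expo n 0 (k - i)).
Proof. exact: (@conv_expo _ n 0 0). Qed.

Lemma mul_supp n u v : laurent_supp n 0 u -> laurent_supp n 0 v ->
  laurent_supp n 0 (u * v).
Proof. exact: (@conv_supp _ n 0 0). Qed.

Lemma puiseux_of_seq n (c : nat -> K) : (0 < n)%N ->
  exists u, laurent_supp n 0 u /\ forall k, u (expo n 0 k) = c k.
Proof.
move=> n0.
pose g q := xget 0 [set y | exists2 k, q = expo n 0 k & y = c k]%classic.
have gE k : g (expo n 0 k) = c k.
  by apply: xget_unique => [|y [l /(expo_inj n0) <-]]//; exists k.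
have gS : laurent_supp n 0 g.
  move=> q gq; apply: contrapT => N; move/eqP: gq; apply.
  by apply: xgetPN => y [k qE _]; apply: N; exists k.
have gP : g \in @is_puiseux K by apply/is_puiseuxP; exists n, 0.
by exists (Puiseux gP).
Qed.

Lemma eq_puiseux n u v : laurent_supp n 0 u -> laurent_supp n 0 v ->
  (forall k, u (expo n 0 k) = v (expo n 0 k)) -> u = v.
Proof. by move=> uS vS uv; apply/val_inj/(eq_laurent uS vS uv). Qed.

(** The exponents lie in an arithmetic progression bounded below, so the support has a least
    element. *)
Lemma puiseux_order u : u != 0 ->
  exists q, u q != 0 /\ forall r, r < q -> u r = 0.
Proof.
move=> u0; have /is_puiseuxP[n [m [n0 uS]]] := puiseux_coefP u.
have ex : exists k, u (expo n m k) != 0.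
  apply: contrapT => /forallNP N; move/eqP: u0; apply; apply/val_inj/funext => q.
  have [//|/[dup] uq /uS[k qE]] := eqVneq (u q) 0.
  by case: (N k); rewrite -qE.
case: (ex_minnP ex) => k uk kmin; exists (expo n m k); split=> // r rk.
apply/eqP; apply: contraTT rk => /[dup] ur /uS[l rE].
rewrite -leNgt rE /expo ler_pM2r ?invr_gt0 ?ltr0n//.
by rewrite ler_int lerD2l lez_nat kmin// -rE.
Qed.

End PuiseuxCoefficients.

(** * Lifting a factorization of the residue P_0 *)

Section DilationHensel.
Local Open Scope complex_scope.
Context {R : realType} {alpha : R} (alpha_gt0 : 0 < alpha).
Local Notation F := (puiseux R[i]).
Local Notation sigma := (dilation alpha_gt0).
Implicit Types (u v : F) (n k : nat).

(** The constant b in t x^(1/n) = b x^(1/n) t. *)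
Definition dilation_root n : R[i] := (alpha `^ n%:R^-1)%:C.

Lemma dilation_root_gt0 n : 0 < dilation_root n.
Proof. by rewrite ltcR powR_gt0. Qed.

Lemma dilation_rootX n k :
  (alpha `^ ratr (expo n 0 k))%:C = dilation_root n ^+ k.
Proof.
rewrite -rmorphXn -powR_mulrn ?powR_ge0// -powRrM /expo add0r.
by rewrite fmorph_div /= ratr_int ratr_nat mulrC.
Qed.

Lemma dilation_root_eq1 n : (0 < n)%N -> dilation_root n = 1 -> alpha = 1.
Proof.
move=> n0 /(congr1 (fun z => z ^+ n)); rewrite expr1n -dilation_rootX.
rewrite /expo add0r divff ?pnatr_eq0 -?lt0n// rmorph1 powRr1 ?ltW//.
by move/(congr1 (@complex.Re R)).
Qed.

Lemma iter_dilation i u q :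
  (iter i sigma u) q = u q * (alpha `^ ratr q)%:C ^+ i.
Proof.
elim: i => [|i IH]; first by rewrite mulr1.
by rewrite [LHS](_ : _ = (iter i sigma u) q * (alpha `^ ratr q)%:C)// IH exprSr mulrA.
Qed.

Lemma iter_dilation_supp i n m u :
  laurent_supp n m u -> laurent_supp n m (iter i sigma u).
Proof.
by move=> uS q; rewrite iter_dilation mulf_eq0 negb_or => /andP[/uS].
Qed.

(** The polynomial P_k of the expansion P = \sum_k x^(k/n) P_k. *)
Definition slice n (P : {poly F}) k : {poly R[i]} :=
  \poly_(i < size P) (P`_i (expo n 0 k)).

Lemma coef_slice n P k i : (slice n P k)`_i = P`_i (expo n 0 k).
Proof.
by rewrite coef_poly; case: ltnP => // Pi; rewrite nth_default.
Qed.

(** The lifted sequences give a polynomial in t for each power of x; regrouped by powers of t, they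
    become the Puiseux coefficients of the two factors. *)
Lemma splits_slice n (P : {poly F}) (g h : {poly R[i]}) : (0 < n)%N ->
    (forall i, laurent_supp n 0 P`_i) -> size (slice n P 0) = size P ->
    (1 < size g)%N -> (1 < size h)%N -> slice n P 0 = g * h ->
    (forall k, (0 < k)%N -> coprimep (g \Po (dilation_root n ^+ k *: 'X)) h) ->
  splits sigma P.
Proof.
move=> n0 PS sP g1 h1 P0 cop.
have nz (p : {poly R[i]}) : (1 < size p)%N -> p != 0.
  by rewrite -size_poly_gt0; case: (size p).
have b0 : dilation_root n != 0 by rewrite gt_eqF ?dilation_root_gt0.
have [|G [H [G0 H0 sG sH GH]]] :=
  hensel _ _ _ _ b0 (nz g g1) (nz h h1) cop P0.
  by move=> k; rewrite sP size_poly.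
have lift (A : nat -> {poly R[i]}) : exists f : nat -> F, forall i,
    laurent_supp n 0 (f i) /\ forall k, f i (expo n 0 k) = (A k)`_i.
  have /choice[f fP] i := puiseux_of_seq n (fun k => (A k)`_i) n0.
  by exists f.
have [gu guP] := lift G; have [hu huP] := lift H.
(* All A_k have size at most s and A_0 has size s: the series vanish from index s on, and the one of
   index s - 1 does not. *)
have trunc (A : nat -> {poly R[i]}) (f : nat -> F) (s : nat) : (forall i,
    laurent_supp n 0 (f i) /\ forall k, f i (expo n 0 k) = (A k)`_i) ->
    (forall k, (size (A k) <= s)%N) -> size (A 0) = s -> (0 < s)%N ->
    (forall i, (\poly_(i < s) f i)`_i = f i) /\ size (\poly_(i < s) f i) = s.
  move=> fP sA A0 s0; split=> [i|].
    rewrite coef_poly; case: ltnP => // si; apply/esym.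
    apply: (@eq_puiseux _ n); first by case: (fP i).
      by move=> q; rewrite eqxx.
    by move=> k; case: (fP i) => _ ->; rewrite nth_default// (leq_trans (sA k)).
  rewrite size_poly_eq//; apply/eqP => /(congr1 (fun u : F => u (expo n 0 0))).
  case: (fP s.-1) => _ -> /eqP; rewrite -A0 -/(lead_coef _) lead_coef_eq0.
  by rewrite -size_poly_eq0 A0 -leqn0 leqNgt s0.
have [||cg sg] := trunc G gu (size g) guP sG; rewrite ?G0//; first exact: ltnW.
have [||ch sh] := trunc H hu (size h) huP sH; rewrite ?H0//; first exact: ltnW.
exists (\poly_(i < size g) gu i), (\poly_(i < size h) hu i).
rewrite sg sh; split=> //; apply/polyP => j.
rewrite (@coef_skew_mul F sigma (\poly_(i < size g) gu i) (\poly_(i < size h) hu i) j).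
apply: (@eq_puiseux _ n); last 2 first.
- exact: PS.
- move=> k; rewrite -coef_slice GH coef_sum puiseux_coef_sum.
  (* Here sigma^i multiplies x^((k - a)/n) by (b^(k - a))^i, the factor that G_a(b^(k - a) X) gives
     to its coefficient of degree i. *)
  transitivity (\sum_(i < j.+1) \sum_(a < k.+1)
    (G a)`_i * (dilation_root n ^+ (k - a)) ^+ i * (H (k - a)%N)`_(j - i)).
    apply: eq_bigr => i _; rewrite cg ch mul_expo//; last 2 first.
    - by case: (guP i).
    - by apply: iter_dilation_supp; case: (huP (j - i)%N).
    apply: eq_bigr => a _; rewrite iter_dilation dilation_rootX.
    by case: (guP i) => _ ->; case: (huP (j - i)%N) => _ ->; rewrite mulrAC mulrA.
  rewrite exchange_big; apply: eq_bigr => a _; rewrite coefM.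
  by apply: eq_bigr => i _; rewrite coef_comp_scaleX.
apply: laurent_supp_sum => i _; rewrite cg ch; apply: mul_supp.
  by case: (guP i).
by apply: iter_dilation_supp; case: (huP (j - i)%N).
Qed.

End DilationHensel.

(** * The cocycle of the substitution t -> b t *)

Section SkewNorm.
Context {F : fieldType} (sigma : {rmorphism F -> F}).

(* (b t)^i = skew_norm b i t^i *)
Fixpoint skew_norm (b : F) i : F :=
  if i is j.+1 then b * sigma (skew_norm b j) else 1.

Lemma skew_norm_neq0 b i : b != 0 -> skew_norm b i != 0.
Proof.
by move=> b0; elim: i => [|i IH] /=; rewrite ?oner_neq0// mulf_neq0// fmorph_eq0.
Qed.

Lemma skew_norm_cocycle b : cocycle sigma (skew_norm b).
Proof.
move=> i j; elim: i => [|i IH]; first by rewrite mul1r.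
by rewrite addSn /= IH rmorphM mulrA.
Qed.

End SkewNorm.

(** * Single-term Puiseux series *)

Section PuiseuxTerms.
Context {K : fieldType}.
Implicit Types (c : K) (u : puiseux K) (q r : rat).

Definition puiseux_term c q := puiseux_scale c (puiseux_X K q).

Lemma mul_termE c q u r : (puiseux_term c q * u) r = c * u (r - q).
Proof.
rewrite [LHS]/= /conv (fsbigE [:: q])//=; last first.
  by move=> i _; rewrite inE /monom => /negbTE ->; rewrite mulr0 mul0r.
by rewrite big_mkcond big_seq1 in_setT /monom eqxx mulr1.
Qed.

Lemma mul_term c d q r :
  puiseux_term c q * puiseux_term d r = puiseux_term (c * d) (q + r).
Proof.
apply/val_inj/funext => s; rewrite [LHS]mul_termE /= /monom mulrA.
by rewrite subr_eq [r + q]addrC.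
Qed.

Lemma puiseux_term1 : puiseux_term 1 0 = 1.
Proof. by apply/val_inj/funext => q; rewrite /= mul1r. Qed.

Lemma puiseux_term_neq0 c q : c != 0 -> puiseux_term c q != 0.
Proof.
apply: contra => /eqP /(congr1 (fun u : puiseux K => u q)).
by rewrite /= /monom eqxx mulr1 => ->.
Qed.

End PuiseuxTerms.

(** * Normalization by the Newton polygon *)

Section NewtonPolygon.
Local Open Scope complex_scope.
Context {R : realType} {alpha : R} (alpha_gt0 : 0 < alpha).
Local Notation F := (puiseux R[i]).
Local Notation sigma := (dilation alpha_gt0).

Lemma dilation_term c q : exists2 d, d != 0 &
  sigma (puiseux_term c q) = puiseux_term (c * d) q.
Proof.
exists (alpha `^ ratr q)%:C; first by rewrite gt_eqF// ltcR powR_gt0.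
rewrite dilation_scale dilation_X; apply/val_inj/funext => r.
by rewrite /= mulrA.
Qed.

Lemma skew_norm_X q i : exists2 c, c != 0 &
  skew_norm sigma (puiseux_X R[i] q) i = puiseux_term c (q * i%:R).
Proof.
have -> : puiseux_X R[i] q = puiseux_term 1 q.
  by apply/val_inj/funext => r; rewrite /= mul1r.
elim: i => [|i [c c0 IH]].
  by exists 1; rewrite ?oner_neq0// mulr0 puiseux_term1.
have [d d0 E] := dilation_term c (q * i%:R); exists (c * d).
  by rewrite mulf_neq0.
rewrite [LHS]/= -/skew_norm IH E mul_term mul1r.
by rewrite -[in RHS]add1n natrD mulrDr mulr1.
Qed.

(** With q the minimum of ord(p_i) / (d - i), the substitution t -> x^q t and division by the new
    leading coefficient make all orders nonnegative, and zero at a minimizing i. *)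
Lemma newton_slope (p : {poly F}) d : p`_d = 1 -> size p = d.+1 ->
    (exists2 i, (i < d)%N & p`_i != 0) ->
  exists (a b : F) n, let P := a *: twist (skew_norm sigma b) p in
    [/\ a != 0, b != 0, (0 < n)%N, (forall i, laurent_supp n 0 P`_i) &
        P`_d = 1 /\ exists2 i, (i < d)%N & P`_i 0 != 0].
Proof.
move=> pd sp [i1 i1d pi1].
(* Here [v i] is the order of p_i, with the dummy value 0 when p_i = 0. *)
have /choice[v vP] i : exists v : rat, p`_i != 0 ->
    p`_i v != 0 /\ forall r, r < v -> p`_i r = 0.
  have [_|/puiseux_order[v vP]] := eqVneq p`_i 0; first by exists 0.
  by exists v.
pose slope (i : 'I_d) : rat := v i / (d - i)%:R.
case: (arg_minP slope (pi1 : (fun i : 'I_d => p`_i != 0) (Ordinal i1d))).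
(* Substituting x^q t for t, where -q is the slope of the edge of the Newton
   polygon through the leading coefficient, makes this edge horizontal. *)
move=> i0 pi0 slope_min; pose q := slope i0.
(* The points (i, v i) lie on or above the line of slope -q through (d, 0). *)
have qv i : (i < d)%N -> p`_i != 0 -> q * (d - i)%:R <= v i.
  move=> id pi; rewrite -ler_pdivlMr ?ltr0n ?subn_gt0//.
  exact: slope_min (Ordinal id) pi.
have [c c0 NE] : exists2 c : nat -> R[i], (forall i, c i != 0) &
    forall i, skew_norm sigma (puiseux_X R[i] q) i = puiseux_term (c i) (q * i%:R).
  have /choice[c cP] i : exists c, c != 0 /\
      skew_norm sigma (puiseux_X R[i] q) i = puiseux_term c (q * i%:R).
    by have [c] := skew_norm_X q i; exists c.
  by exists c => i; case: (cP i).
(* The inverse of the factor that the twist puts on the leading coefficient. *)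
pose a := puiseux_term (c d)^-1 (- (q * d%:R)); pose b := puiseux_X R[i] q.
pose P := a *: twist (skew_norm sigma b) p.
have PE i r : P`_i r = (c d)^-1 * (c i * p`_i (r + q * d%:R - q * i%:R)).
  rewrite /P coefZ coef_twist /b NE [p`_i * _]mulrC /a.
  by rewrite !mul_termE opprK.
have Pd : P`_d = 1.
  by rewrite /P coefZ coef_twist pd mul1r /b NE mul_term mulVf// addNr puiseux_term1.
have Pneg i r : r < 0 -> P`_i r = 0.
  move=> r0; have [id|di|->] := ltngtP i d; last first.
  - by rewrite Pd puiseux_coef1 lt_eqF.
  - by rewrite PE [p`_i]nth_default ?sp// !mulr0.
  rewrite PE; have [->|pi] := eqVneq p`_i 0; first by rewrite !mulr0.
  case: (vP i pi) => _ -> //; rewrite ?mulr0//.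
  apply: lt_le_trans (qv i id pi).
  by rewrite -addrA -mulrBr -natrB ?(ltnW id)// gtrDr.
have b0 : b != 0.
  rewrite (_ : b = puiseux_term 1 q) ?puiseux_term_neq0 ?oner_neq0//.
  by apply/val_inj/funext => r; rewrite /= mul1r.
have [|n [m [n0 S]]] := @common_supp R[i] [seq puiseux_coef P`_i | i <- iota 0 d.+1].
  by move=> f /mapP[i _ ->]; exact: puiseux_coefP.
exists a, b, n; split=> //.
- by rewrite puiseux_term_neq0// invr_eq0.
- move=> i; have [id|id] := ltnP i d.+1; last first.
    rewrite (_ : _`_i = 0) => [r|]; first by rewrite eqxx.
    by rewrite coefZ coef_twist [p`_i]nth_default ?sp// mul0r mulr0.
  apply: (@laurent_supp_nneg _ n m); [by []| |exact: Pneg].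
  by apply: S; rewrite (map_f (fun i => puiseux_coef P`_i))// mem_iota.
split=> //; exists i0; first exact: ltn_ord.
(* At i0 the exponent q (d - i0) equals [v i0]: the lowest term becomes the constant term. *)
rewrite -/P PE !mulf_neq0// ?invr_eq0//.
case: (vP i0 pi0) => + _.
rewrite add0r -mulrBr -natrB ?(ltnW (ltn_ord _))// /q /slope divfK//.
by rewrite pnatr_eq0 subn_eq0 -ltnNge.
Qed.

End NewtonPolygon.

(** * Splitting the residue over an algebraically closed field *)

Section ResidueFactorization.
Context {C : numClosedFieldType}.
Implicit Types (b c z : C) (s : seq C) (p g h : {poly C}).

(** Norms are real, hence comparable, although the order on [C] is partial. *)
Lemma max_norm_mem s : s != [::] ->
  exists2 c, c \in s & forall z, z \in s -> `|z| <= `|c|.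
Proof.
elim: s => // a [|a' s] IH _.
  by exists a; rewrite ?mem_head// => z; rewrite inE => /eqP ->.
have [//|c cs cmax] := IH.
have [ac|ca] := real_leP (normr_real a) (normr_real c).
  exists c; first by rewrite inE cs orbT.
  by move=> z; rewrite inE => /predU1P[->|/cmax].
exists a; first exact: mem_head.
move=> z; rewrite inE => /predU1P[->//|/cmax zc].
exact: le_trans zc (ltW ca).
Qed.

Lemma coprimep_comp_scaleX b g h :
  (forall z, root g (b * z) -> ~~ root h z) -> coprimep (g \Po (b *: 'X)) h.
Proof.
move=> gh; apply: Pdiv.ClosedField.root_coprimep => z.
by rewrite root_comp hornerZ hornerX => /gh.
Qed.

Lemma residue_factorization b p d : 0 < b -> p`_d = 1 -> size p = d.+1 ->
    (1 < d)%N -> (exists2 i, (i < d)%N & p`_i != 0) ->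
    (b = 1 -> p`_d.-1 = 0) ->
  exists g h, [/\ (1 < size g)%N, (1 < size h)%N, p = g * h &
    forall k, (0 < k)%N -> coprimep (g \Po (b ^+ k *: 'X)) h].
Proof.
move=> b0 pd sp d1 [i id pi] b1.
have [s pE] := closed_field_poly_normal p.
have lp : lead_coef p = 1 by rewrite /lead_coef sp.
rewrite lp scale1r in pE.
have ss : size s = d by move: sp; rewrite pE size_prod_XsubC => -[].
have s0 : s != [::] by rewrite -size_eq0 ss; case: d d1 {pd sp id b1 ss}.
have [c cs cmax] := max_norm_mem s s0.
(* If the maximal norm were 0, all roots would be 0 and p = X^d. *)
have c0 : c != 0.
  apply: contra_neq pi => c0.
  have {}s0 : s = nseq d 0.
    rewrite -ss; apply/all_pred1P/allP => z /cmax.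
    by rewrite c0 normr0 normr_le0.
  by rewrite pE {}s0 big_nseq iter_mulr_1 subr0 coefXn ltn_eqF.
have nc0 : 0 < `|c| by rewrite normr_gt0.
have szX : (1 < size ('X - c%:P)%R)%N by rewrite size_XsubC.
have sz_rem : (1 < size (\prod_(z <- rem c s) ('X - z%:P))%R)%N.
  by rewrite size_prod_XsubC size_rem// ss ltnS -ltnS prednK// ltnW.
have norm_b k z : `|b ^+ k * z| = b ^+ k * `|z|.
  by rewrite normrM ger0_norm// exprn_ge0// ltW.
have pE' : p = ('X - c%:P) * \prod_(z <- rem c s) ('X - z%:P).
  by rewrite pE (big_rem c).
(* The roots of g (b^k X) are those of g divided by b^k. When b != 1, a root c of
   maximal norm, put in g if b < 1 and in h if b > 1, is never met by the other
   roots, whatever its multiplicity. When b = 1, all copies of c are put in g. *)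
have [b_lt1|b_gt1|bE] := real_ltgtP (gtr0_real b0) (real1 C).
- exists ('X - c%:P), (\prod_(z <- rem c s) ('X - z%:P)); split=> // k k0.
  apply: coprimep_comp_scaleX => z; rewrite root_XsubC root_prod_XsubC => /eqP bz.
  apply/negP => /mem_rem/cmax; apply/negP; rewrite -real_ltNge ?normr_real//.
  have z0 : 0 < `|z|.
    by rewrite normr_gt0; apply: contraNneq c0 => z0; rewrite -bz z0 mulr0.
  by rewrite -bz norm_b gtr_pMl// exprn_ilt1// ?ltW// -lt0n.
- exists (\prod_(z <- rem c s) ('X - z%:P)), ('X - c%:P); split=> //.
    by rewrite mulrC.
  move=> k k0; apply: coprimep_comp_scaleX => z.
  rewrite root_XsubC root_prod_XsubC => bz; apply/negP => /eqP zc.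
  move/mem_rem/cmax: bz; apply/negP; rewrite -real_ltNge ?normr_real//.
  by rewrite zc norm_b ltr_pMl// exprn_egt1// -lt0n.
have pd1 := b1 bE.
pose eqc z := z == c.
have pF : p = \prod_(z <- filter eqc s) ('X - z%:P) *
              \prod_(z <- filter (predC eqc) s) ('X - z%:P).
  by rewrite pE (bigID eqc) /= !big_filter.
have cF : c \in filter eqc s by rewrite mem_filter /eqc eqxx.
exists (\prod_(z <- filter eqc s) ('X - z%:P)),
  (\prod_(z <- filter (predC eqc) s) ('X - z%:P)); split=> //.
- by rewrite size_prod_XsubC ltnS lt0n size_eq0; apply: contraTneq cF => ->.
- rewrite size_prod_XsubC ltnS lt0n size_eq0 -has_filter.
  apply: contraT => /hasPn allc.
  have sE : s = nseq d c.
    rewrite -ss; apply/all_pred1P/allP => z /allc.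
    by rewrite /= negbK.
  (* If all d roots were c, the coefficient of degree d - 1 would be - d c, which is nonzero. *)
  move: pd1; rewrite pE -[in X in _`_X]ss coefPn_prod_XsubC ?ss; last first.
    by rewrite -lt0n ltnW.
  rewrite sE big_nseq iter_addr_0 => /eqP.
  by rewrite oppr_eq0 mulrn_eq0 (negPf c0) orbF eqn0Ngt ltnW.
- move=> k k0; apply: coprimep_comp_scaleX => z.
  rewrite !root_prod_XsubC !mem_filter /=.
  rewrite /eqc => /andP[/eqP bz _]; rewrite negb_and negbK.
  by move: bz; rewrite bE expr1n mul1r => ->; rewrite eqxx.
Qed.

End ResidueFactorization.

(** * Translation of the variable *)

Section Tschirnhaus.
Context {F : fieldType}.
Implicit Types (p q : {poly F}) (a : F).

Lemma coef_XaddC_exp a i : (('X + a%:P) ^+ i.+1)`_i = a *+ i.+1.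
Proof.
have -> : ('X + a%:P) ^+ i.+1 = \prod_(z <- nseq i.+1 (- a)) ('X - z%:P).
  by rewrite big_nseq iter_mulr_1 polyCN opprK.
have := @coefPn_prod_XsubC F (nseq i.+1 (- a)); rewrite size_nseq => -> //.
by rewrite big_nseq iter_addr_0 mulNrn opprK.
Qed.

Lemma size_comp_XaddC p a : size (p \Po ('X + a%:P)) = size p.
Proof. by rewrite size_comp_poly2// size_XaddC. Qed.

(** Only the powers of X + a of exponents d and d + 1 reach degree d. *)
Lemma coef_comp_XaddC p a d : size p = d.+2 -> p`_d.+1 = 1 ->
  (p \Po ('X + a%:P))`_d.+1 = 1 /\ (p \Po ('X + a%:P))`_d = a *+ d.+1 + p`_d.
Proof.
move=> sp pd; have monX i : lead_coef (('X + a%:P) ^+ i) = 1.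
  by rewrite lead_coef_exp lead_coefXaddC expr1n.
have szX i : size (('X + a%:P) ^+ i) = i.+1.
  rewrite -[LHS]prednK ?size_exp ?size_XaddC ?mul1n//.
  by rewrite size_poly_gt0 -lead_coef_eq0 monX oner_neq0.
have top i : (('X + a%:P) ^+ i)`_i = 1 by rewrite -(monX i) /lead_coef szX.
have low i j : (i < j)%N -> (('X + a%:P) ^+ i)`_j = 0.
  by move=> ij; rewrite nth_default// szX.
split; rewrite coef_comp_poly sp big_ord_recr /= pd mul1r.
  rewrite top big1 ?add0r// => i _.
  by rewrite (low i _ (ltn_ord i)) mulr0.
rewrite addrC coef_XaddC_exp big_ord_recr /= top mulr1 big1 ?add0r// => i _.
by rewrite (low i _ (ltn_ord i)) mulr0.
Qed.

End Tschirnhaus.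

(** * Every skew polynomial of degree at least 2 splits *)

Section Main.
Local Open Scope complex_scope.
Context {R : realType} {alpha : R} (alpha_gt0 : 0 < alpha).
Local Notation F := (puiseux R[i]).
Local Notation sigma := (dilation alpha_gt0).
Implicit Type p : {poly F}.

Lemma splits_Xn d : splits sigma 'X^(d.+2).
Proof.
exists 'X, 'X^(d.+1); rewrite size_polyX size_polyXn; split=> //.
apply/polyP => j; rewrite (@coef_skew_mul F sigma 'X 'X^(d.+1) j).
case: j => [|j]; first by rewrite big_ord1 coefX mul0r coefXn.
rewrite big_ord_recl coefX mul0r add0r big_ord_recl coefX mul1r /= subSS subn0.
rewrite big1 ?addr0 => [|i _]; last by rewrite coefX mul0r.
by rewrite !coefXn eqSS rmorph_nat.
Qed.

(** Either p is a power of t, or the normalized polynomial splits by lifting a factorization of its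
    residue. *)
Lemma splits_depressed p d : size p = d.+3 -> p`_d.+2 = 1 ->
  (alpha = 1 -> p`_d.+1 = 0) -> splits sigma p.
Proof.
move=> sp pd alpha1.
have [[i id pi]|N] := pselect (exists2 i, (i < d.+2)%N & p`_i != 0); last first.
  rewrite (_ : p = 'X^(d.+2)); first exact: splits_Xn.
  apply/polyP => i; rewrite coefXn; have [id|di|->//] := ltngtP i d.+2.
    by apply/eqP; apply: contrapT => /negP pi; apply: N; exists i.
  by rewrite nth_default// sp.
have [|a [b [n [a0 b0 n0 PS [Pd P0]]]]] := newton_slope alpha_gt0 p d.+2 pd sp.
  by exists i.
have N0 j : skew_norm sigma b j != 0 by exact: skew_norm_neq0.
apply: (splits_twist _ _ _ N0 (skew_norm_cocycle sigma b)).
apply: (splits_scale _ _ _ a0).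
set P := a *: _ in PS Pd P0 *.
have sP : size P = d.+3 by rewrite size_scale// size_twist.
have s0d : (slice n P 0)`_d.+2 = 1 by rewrite coef_slice Pd puiseux_coef1 expo00.
have ss : size (slice n P 0) = d.+3.
  by rewrite /slice sP size_poly_eq// Pd puiseux_coef1 expo00 oner_neq0.
have [||g [h [g1 h1 E cop]]] :=
  residue_factorization _ _ _ (dilation_root_gt0 alpha_gt0 n) s0d ss isT.
- by case: P0 => j jd Pj; exists j => //; rewrite coef_slice expo00.
(* b = 1 forces alpha = 1; the twist and the scaling keep a zero coefficient zero. *)
- move=> /(dilation_root_eq1 alpha_gt0 n n0)/alpha1 p1.
  by rewrite coef_slice coefZ coef_twist p1 mul0r mulr0.
by apply: (splits_slice alpha_gt0 n P g h) => //; rewrite ss sP.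
Qed.

Lemma dilation1 : alpha = 1 -> forall u : F, sigma u = u.
Proof.
move=> a1 u; apply/val_inj/funext => q.
by rewrite /= [in X in _ * X]a1 powR1 mulr1.
Qed.

(** For alpha = 1 the skew product is the ordinary one, so translating t is a ring automorphism. *)
Lemma splits_comp p c : alpha = 1 ->
  splits sigma (p \Po ('X + c%:P)) -> splits sigma p.
Proof.
move=> a1; have mulE (g h : {poly F}) : @skew_mul F sigma g h = g * h.
  apply/polyP => k; rewrite [LHS](@coef_skew_mul F sigma g h k) coefM.
  apply: eq_bigr => i _; rewrite (_ : iter i sigma _ = h`_(k - i))//.
  by move: h`_(k - i) => u; elim: (nat_of_ord i) => //= j ->; exact: dilation1.
move=> [g [h [g1 h1]]]; rewrite mulE => E.
exists (g \Po ('X - c%:P)), (h \Po ('X - c%:P)).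
rewrite -polyCN !size_comp_XaddC mulE -comp_polyM E; split=> //.
rewrite -comp_polyA comp_polyD comp_polyX comp_polyC polyCN.
by rewrite subrK comp_polyXr.
Qed.

Lemma puiseux_natr_neq0 d : (d.+1%:R : F) != 0.
Proof.
have E k : (k%:R : F) 0 = k%:R.
  elim: k => // k IH.
  by rewrite -addn1 natrD puiseux_coefD IH puiseux_coef1 eqxx natrD.
apply/eqP => /(congr1 (fun u : F => u 0)); rewrite E => /eqP.
by rewrite puiseux_coef0 pnatr_eq0.
Qed.

Lemma splits_dilation p : (2 < size p)%N -> splits sigma p.
Proof.
move=> sp; have [d dE] : exists d, size p = d.+3.
  by exists (size p - 3)%N; rewrite -addn3 subnK.
have lp : lead_coef p != 0 by rewrite lead_coef_eq0 -size_poly_eq0 dE.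
apply: (splits_scale _ (lead_coef p)^-1); rewrite ?invr_eq0//.
set P := _ *: p; have sP : size P = d.+3 by rewrite size_scale ?invr_eq0.
have Pd : P`_d.+2 = 1 by rewrite coefZ /lead_coef dE mulVf// -[d.+2]/(d.+3.-1) -dE.
have [a1|a1] := eqVneq alpha 1; last first.
  by apply: (splits_depressed P d) => // a1'; rewrite a1' eqxx in a1.
(* Translating by c adds (d + 2) c to the coefficient of degree d + 1, which cancels it. *)
pose c := - (P`_d.+1 / d.+2%:R).
have [Q1 Q0] := coef_comp_XaddC P c d.+1 sP Pd.
apply: (splits_comp P c a1); apply: (splits_depressed _ d) => //.
  by rewrite size_comp_XaddC.
by rewrite Q0 -mulr_natr mulNr divfK ?addNr// puiseux_natr_neq0.
Qed.

End Main.

Theorem theorem1p1 (R : realType) (alpha : R) (alpha_gt0 : 0 < alpha) :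
  skew_algebraically_closed (dilation alpha_gt0).
Proof. exact: closed_of_splits (splits_dilation alpha_gt0). Qed.
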